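(* Let $M$ and $N$ be oriented closed connected manifolds of the same dimension and let $f\colon M\to N$ be a continuous map. (1) If $R$ is a commutative ring with unit and $\deg f$ is a unit in $R$ (i.e. the image of $\deg f\in\mathbb{Z}$ under the canonical ring homomorphism $\mathbb{Z}\to R$ is a unit), then $\|N\|_{(R)}\le\|M\|_{(R)}$. (2) In particular: if $\deg f\neq 0$, then $\|N\|_{(\mathbb{Q})}\le\|M\|_{(\mathbb{Q})}$; and if $p\in\mathbb{N}$ is a prime number with $p\nmid\deg f$, then $\|N\|_{(\mathbb{F}_p)}\le\|M\|_{(\mathbb{F}_p)}$.
   Context: Closed means compact without boundary. Let $R$ be a commutative ring with unit and let $M$ be an oriented closed connected $n$-manifold. An $R$-fundamental cycle of $M$ is a singular cycle in $C_n(M;R)$ representing the $R$-fundamental class $[M]_R \in H_n(M;R)$, the image of the integral fundamental class under $\mathbb{Z}\to R$. The weightless $R$-simplicial volume of $M$ is $$\|M\|_{(R)} := \min\Bigl\{ m \in \mathbb{N} \Bigm| \sum_{j=1}^m a_j\cdot\sigma_j \in C_n(M;R) \text{ is an } R\text{-fundamental cycle of } M\Bigr\}.$$ *)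

(* Defs.v *)
From HB Require Import structures.
From mathcomp Require Import all_boot all_order all_algebra finmap.
From mathcomp Require Import all_classical all_reals all_analysis.
From mathcomp Require monalg.
(* The notations of [monalg] clash with those of MathComp-Analysis. *)
Import -(notations) monalg.

Set Implicit Arguments.
Unset Strict Implicit.
Unset Printing Implicit Defensive.

Import Order.TTheory GRing.Theory Num.Theory.
Import numFieldNormedType.Exports.

Local Open Scope classical_set_scope.
Local Open Scope ring_scope.
Local Open Scope quotient_scope.

Section StandardSimplex.
Context (K : realType).

Definition std_simplex (n : nat) : set 'rV[K]_n.+1 :=
  [set t | (forall i, 0 <= t 0 i) /\ \sum_i t 0 i = 1].
Arguments std_simplex n : clear implicits.

(* The i-th face inclusion: insert 0 at position i. *)
Definition face_fun n (i : 'I_n.+2) (t : 'rV[K]_n.+1) : 'rV[K]_n.+2 :=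
  \row_j oapp (fun k => t 0 k) 0 (unlift i j).

Lemma face_fun_simplex n (i : 'I_n.+2) (t : std_simplex n) :
  face_fun i (\val t) \in std_simplex n.+1.
Proof.
case: t => t /= /set_mem [t0 t1]; apply/mem_set; split => [j|].
  by rewrite mxE; case: unliftP => [k _|_] /=.
rewrite (bigD1_ord i) //= mxE unlift_none /= add0r -[RHS]t1.
by apply: eq_bigr => k _; rewrite mxE liftK.
Qed.

Definition face_map n (i : 'I_n.+2) (t : std_simplex n) : std_simplex n.+1 :=
  exist _ (face_fun i (\val t)) (face_fun_simplex i t).

Lemma face_fun_continuous n (i : 'I_n.+2) : continuous (@face_fun n i).
Proof.
move=> t A [B /= tB BA].
exists (fun _ k => B 0 (lift i k)) => [a k|s Bs].
  by rewrite (ord1 a); move: (tB 0 (lift i k)); rewrite mxE liftK.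
apply: BA => a j; rewrite (ord1 a) mxE; case: unliftP => [k ->|ji] /=.
  exact: Bs 0 k.
by have := nbhs_singleton (tB 0 j); rewrite mxE ji unlift_none.
Qed.

Lemma face_map_continuous n (i : 'I_n.+2) : continuous (@face_map n i).
Proof.
apply: continuous_comp_initial => t.
apply: (@continuous_comp _ _ _ (\val : std_simplex n -> _) (face_fun i)).
  exact: initial_continuous.
exact: face_fun_continuous.
Qed.

HB.instance Definition _ n (i : 'I_n.+2) :=
  isContinuous.Build _ _ (@face_map n i) (@face_map_continuous n i).

End StandardSimplex.
Arguments std_simplex K n : clear implicits.
Arguments face_map {K n} i t.

Lemma malg_sum_additive (S : choiceType) (G V : zmodType) (g : S -> G -> V) :
    (forall s, zmod_morphism (g s)) ->
  zmod_morphism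
    (fun c : monalg.malg S G => \sum_(s <- msupp c) g s (mcoeff s c)).
Proof.
move=> gB; have g0 s : g s 0 = 0 by have := gB s 0 0; rewrite !subrr.
have wid (E : {fset S}) (c : malg S G) : (msupp c `<=` E)%fset ->
    \sum_(s <- msupp c) g s (mcoeff s c) = \sum_(s <- E) g s (mcoeff s c).
  move=> sE; apply: big_fset_incl => // s _ sc.
  by rewrite mcoeff_outdom.
move=> c d; pose E := (msupp c `|` msupp d)%fset.
rewrite (wid E _ (msuppB_le c d)) (wid E c) ?fsubsetUl //.
rewrite (wid E d) ?fsubsetUr // -sumrB.
by apply: eq_bigr => s _; rewrite mcoeffB gB.
Qed.


Lemma malg_sumU (S : choiceType) (G V : zmodType) (g : S -> G -> V) s a :
    (forall s, zmod_morphism (g s)) ->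
  \sum_(t <- msupp (mkmalgU s a)) g t (mcoeff t (mkmalgU s a)) = g s a.
Proof.
move=> gB; have g0 t : g t 0 = 0 by have := gB t 0 0; rewrite !subrr.
rewrite msuppU; case: eqVneq => [->|a0]; first by rewrite big_seq_fset0 g0.
by rewrite big_seq_fset1 mcoeffUU.
Qed.

Lemma malg_additive_ext (S : choiceType) (G V : zmodType)
    (F H : {additive malg S G -> V}) :
  (forall s a, F (mkmalgU s a) = H (mkmalgU s a)) -> F =1 H.
Proof.
move=> FH c; rewrite (monalgE c) !raddf_sum; apply: eq_bigr => s _; exact: FH.
Qed.

Section SingularHomology.
Context (K : realType).

Definition simplex (n : nat) (X : topologicalType) : Type :=
  continuousType (std_simplex K n) X.
HB.instance Definition _ n X := Choice.on (simplex n X).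

Definition face n (X : topologicalType) (i : 'I_n.+2) (s : simplex n.+1 X) :
  simplex n X := (s : continuousType _ _) \o face_map i.

Definition chain (n : nat) (X : topologicalType) (R : zmodType) : Type :=
  malg (simplex n X) R.
HB.instance Definition _ n X R := GRing.Zmodule.on (chain n X R).

Section Homology.
Context (X : topologicalType) (A : set X) (R : comPzRingType).

Definition boundary n (c : chain n.+1 X R) : chain n X R :=
  \sum_(s <- msupp c)
    \sum_(i < n.+2) mkmalgU (face i s) ((-1) ^+ i * mcoeff s c).

Lemma boundary_additive n : zmod_morphism (@boundary n).
Proof.
apply: (malg_sum_additive (g := fun s a =>
  \sum_(i < n.+2) mkmalgU (face i s) ((-1) ^+ i * a))) => s a b.
rewrite -sumrB.
by apply: eq_bigr => i _; rewrite mulrBr raddfB.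
Qed.
HB.instance Definition _ n :=
  GRing.isZmodMorphism.Build _ _ (@boundary n) (@boundary_additive n).

Definition chain_in n : pred (chain n X R) :=
  fun c => `[< forall s, s \in msupp c -> range s `<=` A >].

Lemma chain_in_zmod n : zmod_closed (@chain_in n).
Proof.
split=> [|c d]; first by apply/asboolP => s; rewrite msupp0.
move=> /asboolP cA /asboolP dA; apply/asboolP => s.
move=> /(fsubsetP (msuppB_le _ _)); rewrite inE => /orP[]; [exact: cA|exact: dA].
Qed.
HB.instance Definition _ n :=
  GRing.isZmodClosed.Build _ (@chain_in n) (@chain_in_zmod n).

Definition is_cycle n : pred (chain n X R) :=
  match n with
  | 0 => xpredT
  | m.+1 => fun c => boundary c \in @chain_in m
  end.

Lemma is_cycleS n (c : chain n.+1 X R) :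
  (c \in @is_cycle n.+1) = (boundary c \in @chain_in n).
Proof. by rewrite {1}unfold_in. Qed.

Lemma is_cycle_zmod n : zmod_closed (@is_cycle n).
Proof.
case: n => [//|n]; split=> [|c d]; rewrite !is_cycleS.
  by rewrite [boundary 0]raddf0; exact: rpred0.
by rewrite [boundary (c - d)]raddfB; exact: rpredB.
Qed.
HB.instance Definition _ n :=
  GRing.isZmodClosed.Build _ (@is_cycle n) (@is_cycle_zmod n).

Record cycle n := Cycle { cycle_val :> chain n X R; _ : cycle_val \in @is_cycle n }.
HB.instance Definition _ n := [isSub for @cycle_val n].
HB.instance Definition _ n := [Choice of cycle n by <:].
HB.instance Definition _ n := [SubChoice_isSubZmodule of cycle n by <:].

Definition is_boundary n : pred (cycle n) :=
  fun z => `[< exists b : chain n.+1 X R, \val z - boundary b \in @chain_in n >].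

Lemma is_boundary_zmod n : zmod_closed (@is_boundary n).
Proof.
split=> [|z w].
  by apply/asboolP; exists 0; rewrite [boundary 0]raddf0 subr0; exact: rpred0.
move=> /asboolP[b zb] /asboolP[c wc]; apply/asboolP; exists (b - c).
rewrite [boundary (b - c)]raddfB [\val _]raddfB.
rewrite opprD addrACA -opprD; exact: rpredB.
Qed.
HB.instance Definition _ n :=
  GRing.isZmodClosed.Build _ (@is_boundary n) (@is_boundary_zmod n).


(* H_n(X, A; R) as relative cycles modulo relative boundaries. The absolute group
   H_n(X; R) is the case A = set0, where [chain_in] only contains 0, see
   [chain_in_set0] below. *)
Definition homology n : zmodType := 
  Quotient.quot (GRing.ZmodClosed.clone (cycle n) (@is_boundary n) _).

Definition hclass n (z : cycle n) : homology n := \pi_(homology n) z.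

Lemma hclassP n (z w : cycle n) :
  hclass z = hclass w <->
  exists b : chain n.+1 X R, \val z - \val w - boundary b \in @chain_in n.
Proof.
rewrite /hclass; split=> [/eqP|[b zwb]].
  by rewrite -Quotient.idealrBE => /asboolP[b]; rewrite [\val _]raddfB; exists b.
by apply/eqP; rewrite -Quotient.idealrBE; apply/asboolP; exists b; rewrite [\val _]raddfB.
Qed.

End Homology.

Lemma chain_in_set0 (X : topologicalType) (R : comPzRingType) n
    (c : chain n X R) :
  c \in @chain_in X set0 R n -> c = 0.
Proof.
move=> /asboolP c0; apply/malgP => s; rewrite mcoeff0.
apply: mcoeff_outdom; apply/negP => /c0 s0.
pose t : 'rV[K]_n.+1 := \row_j (j == 0)%:R.
have tD : t \in std_simplex K n.
  apply/mem_set; split => [j|]; first by rewrite mxE ler0n.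
  rewrite (bigD1 0) //= mxE eqxx big1 ?addr0 // => j /negbTE j0.
  by rewrite mxE j0.
by apply: (s0 ((s : continuousType _ _) (exist _ t tD))); exists (exist _ t tD).
Qed.

Section BoundaryU.
Context (X : topologicalType) (R : comPzRingType) (n : nat).

Lemma boundaryU (s : simplex n.+1 X) (a : R) :
  boundary (mkmalgU s a) =
  \sum_(i < n.+2) mkmalgU (face i s) ((-1) ^+ i * a) :> chain n X R.
Proof.
apply: (@malg_sumU _ _ _ (fun s a =>
  \sum_(i < n.+2) mkmalgU (face i s) ((-1) ^+ i * a))) => {}s b c.
rewrite -sumrB; by apply: eq_bigr => i _; rewrite mulrBr raddfB.
Qed.

End BoundaryU.

Section Pushforward.
Context (X Y : topologicalType) (f : continuousType X Y) (R : comPzRingType).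

Definition comp_simplex n (s : simplex n X) : simplex n Y :=
  f \o (s : continuousType _ _).

Definition push n (c : chain n X R) : chain n Y R :=
  \sum_(s <- msupp c) mkmalgU (comp_simplex s) (mcoeff s c).

Lemma push_additive n : zmod_morphism (@push n).
Proof.
apply: (malg_sum_additive (g := fun s a => mkmalgU (comp_simplex s) a)).
by move=> s a b; rewrite raddfB.
Qed.
HB.instance Definition _ n :=
  GRing.isZmodMorphism.Build _ _ (@push n) (@push_additive n).

Lemma pushU n (s : simplex n X) (a : R) :
  push (mkmalgU s a) = mkmalgU (comp_simplex s) a.
Proof.
apply: (@malg_sumU _ _ _ (fun s a => mkmalgU (comp_simplex s) a)).
by move=> {}s b c; rewrite raddfB.
Qed.

Lemma comp_simplex_face n i (s : simplex n.+1 X) :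
  comp_simplex (face i s) = face i (comp_simplex s).
Proof. exact/continuousEP. Qed.

Lemma boundary_push n (c : chain n.+1 X R) :
  boundary (push c) = push (boundary c).
Proof.
apply: (@malg_additive_ext _ _ _ (@boundary Y R n \o @push n.+1)
  (@push n \o @boundary X R n)) => s a /=.
rewrite pushU !boundaryU raddf_sum; apply: eq_bigr => i _.
by rewrite /= pushU comp_simplex_face.
Qed.

Context (A : set X) (B : set Y) (fAB : A `<=` f @^-1` B).

Lemma push_in n (c : chain n X R) :
  c \in @chain_in X A R n -> push c \in @chain_in Y B R n.
Proof.
move=> /asboolP cA; rewrite /push big_seq; apply: rpred_sum => s /cA sA.
apply/asboolP => u /(fsubsetP msuppU_le)/fset1P -> _ [t _ <-].
by apply: fAB; apply: sA; exists t.
Qed.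

Lemma push_is_cycle n (z : cycle A R n) : push z \in @is_cycle Y B R n.
Proof.
case: n z => [//|n] [z /= zc]; rewrite is_cycleS boundary_push.
by apply: push_in; rewrite -is_cycleS.
Qed.

Definition push_cycle n (z : cycle A R n) : cycle B R n :=
  Cycle (push_is_cycle z).

Definition induced n (h : homology A R n) : homology B R n :=
  hclass (push_cycle (repr h)).

Lemma induced_hclass n (z : cycle A R n) :
  induced (hclass z) = hclass (push_cycle z).
Proof.
apply/hclassP; have /hclassP[b zb] : hclass (repr (hclass z)) = hclass z.
  exact: reprK.
by exists (push b); rewrite boundary_push; move/push_in: zb; rewrite !raddfB.
Qed.

End Pushforward.

Section ChangeOfCoefficients.
Context (R S : comPzRingType) (phi : {rmorphism R -> S}).
Context (X : topologicalType).

Definition change_chain n (c : chain n X R) : chain n X S :=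
  \sum_(s <- msupp c) mkmalgU s (phi (mcoeff s c)).

Lemma change_chain_additive n : zmod_morphism (@change_chain n).
Proof.
apply: (malg_sum_additive (g := fun s a => mkmalgU s (phi a))).
by move=> s a b; rewrite !raddfB.
Qed.
HB.instance Definition _ n :=
  GRing.isZmodMorphism.Build _ _ (@change_chain n) (@change_chain_additive n).

Lemma change_chainU n (s : simplex n X) (a : R) :
  change_chain (mkmalgU s a) = mkmalgU s (phi a).
Proof.
apply: (@malg_sumU _ _ _ (fun s a => mkmalgU s (phi a))).
by move=> {}s b c; rewrite !raddfB.
Qed.

Lemma boundary_change n (c : chain n.+1 X R) :
  boundary (change_chain c) = change_chain (boundary c).
Proof.
apply: (@malg_additive_ext _ _ _ (@boundary X S n \o @change_chain n.+1)
  (@change_chain n \o @boundary X R n)) => s a /=.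
rewrite change_chainU !boundaryU raddf_sum; apply: eq_bigr => i _.
by rewrite /= change_chainU rmorphM rmorph_sign.
Qed.

Context (A : set X).

Lemma change_in n (c : chain n X R) :
  c \in @chain_in X A R n -> change_chain c \in @chain_in X A S n.
Proof.
move=> /asboolP cA; rewrite /change_chain big_seq; apply: rpred_sum => s /cA sA.
by apply/asboolP => u /(fsubsetP msuppU_le)/fset1P ->.
Qed.

Lemma change_is_cycle n (z : cycle A R n) :
  change_chain z \in @is_cycle X A S n.
Proof.
case: n z => [//|n] [z /= zc]; rewrite is_cycleS boundary_change.
by apply: change_in; rewrite -is_cycleS.
Qed.

Definition change_cycle n (z : cycle A R n) : cycle A S n :=
  Cycle (change_is_cycle z).

Definition change_coeff n (h : homology A R n) : homology A S n :=
  hclass (change_cycle (repr h)).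

Lemma change_coeff_hclass n (z : cycle A R n) :
  change_coeff (hclass z) = hclass (change_cycle z).
Proof.
apply/hclassP; have /hclassP[b zb] : hclass (repr (hclass z)) = hclass z.
  exact: reprK.
exists (change_chain b); rewrite boundary_change.
by move/change_in: zb; rewrite !raddfB.
Qed.

End ChangeOfCoefficients.

End SingularHomology.

Definition restrict (K : realType) (X : topologicalType) (A B : set X)
    (AB : A `<=` B) (R : comPzRingType) (n : nat) :
  homology K A R n -> homology K B R n := @induced K X X idfun R A B AB n.

Lemma subsetC_set1 (X : Type) (U : set X) (x : X) :
  U x -> ~` U `<=` ~` [set x].
Proof. by move=> Ux; apply: subsetC => _ ->. Qed.

Definition locally_euclidean (K : realType) (n : nat) (X : topologicalType) :=
  forall x : X, exists (U : set X) (phi : X -> 'rV[K]_n) (psi : 'rV[K]_n -> X),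
    [/\ open_nbhs x U, open (phi @` U), {within U, continuous phi},
        {within phi @` U, continuous psi} & {in U, cancel phi psi}].

(* An orientation is a choice of a generator of H_n(X, X \ {x}; Z) for every x
   which, near each point, is induced by a single class of H_n(X, X \ U; Z). *)
Definition is_orientation (K : realType) (n : nat) (X : topologicalType)
    (mu : forall x : X, homology K (~` [set x]) int n) :=
  (forall x a, exists k : int, a = mu x *~ k) /\
  (forall x, exists2 U : set X, open_nbhs x U &
    exists muU : homology K (~` U) int n,
      forall y (Uy : U y), restrict (subsetC_set1 Uy) muU = mu y).

(* Charts take values in K^n, so there is no boundary. *)
Record oc_manifold (K : realType) (n : nat) := OCManifold {
  carrier :> topologicalType;
  ocm_hausdorff : hausdorff_space carrier;
  ocm_second_countable : @second_countable carrier;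
  ocm_locally_euclidean : locally_euclidean K n carrier;
  ocm_compact : compact [set: carrier];
  ocm_connected : connected [set: carrier];
  ocm_nonempty : [set: carrier] !=set0;
  orientation : forall x : carrier, homology K (~` [set x]) int n;
  orientationP : is_orientation orientation
}.

Section FundamentalClass.
Context (K : realType) (n : nat).
Implicit Types M N : oc_manifold K n.

(* By a classical theorem exactly one class restricts to the orientation at
   every point; the default value 0 is thus never taken. *)
Definition fundamental_class M : homology K set0 int n :=
  xget 0 [set a | forall x : M,
    restrict (@sub0set M (~` [set x])) a = orientation x].

Definition fundamental_class_in (R : comPzRingType) M : homology K set0 R n :=
  change_coeff (intr : {rmorphism int -> R}) (fundamental_class M).

Definition is_fundamental_cycle (R : comPzRingType) M (c : chain K n M R) :=
  exists z : cycle K (@set0 M) R n, \val z = c /\ hclass z = fundamental_class_in R M.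

(* The coefficients a_j may vanish and the simplices s_j need not be distinct. *)
Definition has_fundamental_cycle_of_length (R : comPzRingType) M : pred nat :=
  fun m => `[< exists (a : 'I_m -> R) (s : 'I_m -> simplex K n M),
    is_fundamental_cycle (\sum_(j < m) mkmalgU (s j) (a j)) >].

Lemma has_fundamental_cycle (R : comPzRingType) M :
  exists m, has_fundamental_cycle_of_length R M m.
Proof.
pose z := repr (fundamental_class_in R M).
pose E := msupp (\val z).
exists (size E); apply/asboolP.
exists (fun j => mcoeff (tnth (in_tuple E) j) (\val z)).
exists (fun j => tnth (in_tuple E) j); exists z; split; last exact: reprK.
by rewrite [LHS]monalgE [LHS]big_tnth.
Qed.

Definition weightless_volume (R : comPzRingType) M : nat :=
  ex_minn (has_fundamental_cycle R M).

(* The induced map H_n(M; Z) -> H_n(N; Z). *)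
Definition induced_abs M N (f : continuousType M N) :
  homology K (@set0 M) int n -> homology K (@set0 N) int n :=
  induced (@sub0set M (f @^-1` set0)) (n := n).

(* The integer d with f_*[M] = d [N]; it exists and is unique because [N]
   generates H_n(N; Z), which is infinite cyclic. *)
Definition degree M N (f : continuousType M N) : int :=
  xget 0 [set d : int |
    induced_abs f (fundamental_class M) = fundamental_class N *~ d].

End FundamentalClass.

(* Main.v *)
From HB Require Import structures.
From mathcomp Require Import all_boot all_order all_algebra finmap.
From mathcomp Require Import all_classical all_reals all_analysis.
From mathcomp Require monalg.
Import -(notations) monalg.
Require Import Defs.

Set Implicit Arguments.
Unset Strict Implicit.
Unset Printing Implicit Defensive.

Import GRing.Theory Num.Theory.

Local Open Scope ring_scope.

(** Let [z] be an [R]-fundamental cycle of [M] written with as few simplices as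
possible, let [d] be the degree of [f] and [u] the inverse of [d] in [R]. Since
[f] maps [[M]] to [d] times [[N]], the chain [u f_*(z)] represents
[u d [N] = [N]], and it is written with the same number of simplices as [z]:
pushing forward and rescaling act on a formal sum term by term. All this happens
on chains: a cycle represents the [R]-fundamental class exactly when it differs
by a boundary from the change of coefficients of an integral fundamental cycle
([is_fundamental_cycleP]), and boundaries commute with pushforward, change of
coefficients and rescaling.

The relation [f_*[M] = d [N]] is read off the definition of the degree: [d] is
chosen to satisfy it whenever some integer does, and is [0] otherwise; in the
latter case, [0] being invertible forces [R] to be the zero ring
([degree_unit]), over which the empty sum is a fundamental cycle. The statements
over the rationals and over prime fields follow because there being nonzero and
being a unit are the same. *)

Section Scale.
Context (K : realType) (X : topologicalType) (R : comPzRingType) (u : R).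

(** The scalar action of [R] on chains, in the form in which [malg_sumU] and
[malg_additive_ext] reduce it to single simplices; the zero ring is allowed. *)
Definition scale_chain n (c : chain K n X R) : chain K n X R :=
  \sum_(s <- msupp c) mkmalgU s (u * mcoeff s c).

Lemma scale_chain_additive n : zmod_morphism (@scale_chain n).
Proof.
apply: (malg_sum_additive (g := fun s a => mkmalgU s (u * a))).
by move=> s a b; rewrite mulrBr raddfB.
Qed.
HB.instance Definition _ n :=
  GRing.isZmodMorphism.Build _ _ (@scale_chain n) (@scale_chain_additive n).

Lemma scale_chainU n (s : simplex K n X) (a : R) :
  scale_chain (mkmalgU s a) = mkmalgU s (u * a).
Proof.
apply: (@malg_sumU _ _ _ (fun s a => mkmalgU s (u * a))).
by move=> {}s b c; rewrite mulrBr raddfB.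
Qed.

Lemma boundary_scale n (c : chain K n.+1 X R) :
  boundary (scale_chain c) = scale_chain (boundary c).
Proof.
apply: (@malg_additive_ext _ _ _ (@boundary K X R n \o @scale_chain n.+1)
  (@scale_chain n \o @boundary K X R n)) => s a /=.
rewrite scale_chainU !boundaryU raddf_sum; apply: eq_bigr => i _.
by rewrite /= scale_chainU mulrCA.
Qed.

Lemma scale_in (A : set X) n (c : chain K n X R) :
  c \in @chain_in K X A R n -> scale_chain c \in @chain_in K X A R n.
Proof.
move=> /asboolP cA; rewrite /scale_chain big_seq; apply: rpred_sum => s /cA sA.
by apply/asboolP => t /(fsubsetP msuppU_le)/fset1P ->.
Qed.

Lemma scale_is_cycle (A : set X) n (c : chain K n X R) :
  c \in @is_cycle K X A R n -> scale_chain c \in @is_cycle K X A R n.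
Proof.
case: n c => [//|n] c; rewrite !is_cycleS boundary_scale; exact: scale_in.
Qed.

Lemma scale_chainMz n (c : chain K n X R) (d : int) :
  u * d%:~R = 1 -> scale_chain (c *~ d) = c.
Proof.
move=> ud; rewrite raddfMz [RHS]monalgE mulrz_suml.
by apply: eq_bigr => s _; rewrite -raddfMz -mulrzr -mulrA mulrCA ud mulr1.
Qed.

End Scale.

Lemma change_push (K : realType) (X Y : topologicalType)
    (f : continuousType X Y) (R S : comPzRingType) (phi : {rmorphism R -> S}) n
    (c : chain K n X R) :
  change_chain phi (push f c) = push f (change_chain phi c).
Proof.
apply: (@malg_additive_ext _ _ _
  (@change_chain K R S phi Y n \o @push K X Y f R n)
  (@push K X Y f S n \o @change_chain K R S phi X n)) => s a /=.
by rewrite pushU !change_chainU pushU.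
Qed.

(** In absolute homology, equal classes differ by a boundary on the nose, as
the only chain in the empty set is [0]. *)
Lemma hclass_set0P (K : realType) (X : topologicalType) (R : comPzRingType) n
    (z w : cycle K (@set0 X) R n) :
  hclass z = hclass w <->
  exists b : chain K n.+1 X R, \val z = \val w + boundary b.
Proof.
split=> [/hclassP[b /chain_in_set0/eqP]|[b zwb]].
  by rewrite -addrA -opprD subr_eq0 => /eqP zwb; exists b.
apply/hclassP; exists b.
by rewrite zwb [X in X - boundary b]addrC addKr subrr rpred0.
Qed.

Lemma hclassMz (K : realType) (X : topologicalType) (A : set X)
    (R : comPzRingType) n (z : cycle K A R n) (d : int) :
  hclass (z *~ d) = hclass z *~ d.
Proof. by rewrite /hclass raddfMz. Qed.

Section FundamentalCycles.
Context (K : realType) (n : nat).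
Implicit Types M N : oc_manifold K n.

Definition integral_fundamental_cycle M : cycle K (@set0 M) int n :=
  repr (fundamental_class M).

(** Comparing with one fixed integral cycle turns statements about classes into
identities between chains. *)
Lemma is_fundamental_cycleP (R : comPzRingType) M (c : chain K n M R) :
  is_fundamental_cycle c <->
  c \in @is_cycle K M set0 R n /\
  exists b, c = change_chain (intr : {rmorphism int -> R})
                  (\val (integral_fundamental_cycle M)) + boundary b.
Proof.
split=> [[z [<- /hclass_set0P zb]]|[cc cb]].
  by split=> //; apply: valP.
by exists (Cycle cc); split=> //; apply/hclass_set0P.
Qed.

(** If no integer is a degree of [f], then [degree f] is [0], and this is a unit
only in the zero ring. *)
Lemma degree_unit (R : comPzRingType) M N (f : continuousType M N) (u : R) :
  u * (degree f)%:~R = 1 ->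
  (1 = 0 :> R) \/
  induced_abs f (fundamental_class M) = fundamental_class N *~ degree f.
Proof.
rewrite /degree; case: xgetP => [d _ dP _|_]; first by right.
by rewrite mulr0 => <-; left.
Qed.

Lemma push_integral_fundamental_cycle M N (f : continuousType M N) (d : int) :
  induced_abs f (fundamental_class M) = fundamental_class N *~ d ->
  exists b, push f (\val (integral_fundamental_cycle M)) =
    \val (integral_fundamental_cycle N) *~ d + boundary b.
Proof.
rewrite -[X in induced_abs f X]reprK -[X in X *~ d]reprK.
rewrite [LHS]induced_hclass -hclassMz => /hclass_set0P[b].
by rewrite [\val (_ *~ d)]raddfMz; exists b.
Qed.

(** If [z] represents [[M]], then [u f_*(z)] represents [u d [N] = [N]]. *)
Lemma scale_push_fundamental_cycle (R : comPzRingType) M N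
    (f : continuousType M N) (u : R) (d : int) (c : chain K n M R) :
  induced_abs f (fundamental_class M) = fundamental_class N *~ d ->
  u * d%:~R = 1 -> is_fundamental_cycle c ->
  is_fundamental_cycle (scale_chain u (push f c)).
Proof.
move=> /push_integral_fundamental_cycle[b fb] ud.
move=> /is_fundamental_cycleP[cc [e ce]].
apply/is_fundamental_cycleP; split.
  apply: scale_is_cycle.
  exact: (push_is_cycle (@sub0set M (f @^-1` set0)%classic) (Cycle cc)).
exists (scale_chain u (change_chain intr b + push f e)).
rewrite ce raddfD /= -change_push fb !raddfD /= raddfMz scale_chainMz //.
by rewrite !boundary_scale boundary_change boundary_push addrA.
Qed.

(** Over the zero ring every chain is [0], hence equal to the empty sum. *)
Lemma weightless_volume_zero_ring (R : comPzRingType) M :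
  1 = 0 :> R -> weightless_volume R M = 0%N.
Proof.
move=> R0; have chain0 (c : chain K n M R) : c = 0.
  by apply/malgP => s; rewrite -[LHS]mulr1 -[RHS]mulr1 R0 !mulr0.
apply/eqP; rewrite -leqn0 /weightless_volume; case: ex_minnP => m _; apply.
apply/asboolP; exists (fun=> 0).
exists (fun j : 'I_0 => match notF (ltn_ord j) with end).
exists (repr (fundamental_class_in R M)).
by split; [rewrite [LHS]chain0 [RHS]chain0 | exact: reprK].
Qed.

Lemma weightless_volume_le_of_degree_unit (R : comPzRingType) M N
    (f : continuousType M N) (u : R) :
  u * (degree f)%:~R = 1 ->
  (weightless_volume R N <= weightless_volume R M)%N.
Proof.
move=> ud; case: (degree_unit ud) => [/weightless_volume_zero_ring->//|fd].
rewrite /weightless_volume; case: ex_minnP => k _ kmin.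
case: ex_minnP => m /asboolP[a [s sM]] _; apply/kmin/asboolP.
exists (fun j => u * a j), (fun j => comp_simplex f (s j)).
(* The chain [u f_*(z)], expanded term by term, again has [m] terms. *)
have := scale_push_fundamental_cycle fd ud sM.
rewrite [push f _]raddf_sum [scale_chain u _]raddf_sum.
congr (is_fundamental_cycle _); apply: eq_bigr => j _.
by rewrite /= pushU scale_chainU.
Qed.

End FundamentalCycles.

Theorem proposition2p3 (K : realType) (n : nat) (M N : oc_manifold K n)
    (f : continuousType M N) :
  (forall R : comPzRingType,
     (exists u : R, u * (degree f)%:~R = 1) ->
     (weightless_volume R N <= weightless_volume R M)%N) /\
  ((degree f != 0 ->
      (weightless_volume rat N <= weightless_volume rat M)%N) /\
   (forall p : nat, prime p -> ~~ (p%:Z %| degree f)%Z ->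
      (weightless_volume 'F_p N <= weightless_volume 'F_p M)%N)).
Proof.
have unit_case (R : comPzRingType) : (exists u : R, u * (degree f)%:~R = 1) ->
    (weightless_volume R N <= weightless_volume R M)%N.
  by case=> u; exact: weightless_volume_le_of_degree_unit.
split; [exact: unit_case|split=> [d0|p p_prime pd]]; apply: unit_case.
  by exists ((degree f)%:~R^-1); rewrite mulVf // intr_eq0.
exists ((degree f)%:~R^-1); rewrite mulVf //.
by rewrite -(dvdz_pcharf (pchar_Fp p_prime)).
Qed.
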